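(* Let $f\in C^1(\mathbb{R})$ be a non-decreasing function, and let $$F(a,b)=\frac{f(a)-f(b)}{a-b}\ \text{ for } a\ne b,\qquad F(a,a)=f'(a).$$ Let $\mu$ be the density of a Lévy measure with low singularity. Then $\rho(a,b;x,y)=F(a,b)\,\mu(|x-y|)$ is a homogeneous jump kernel.
   Context: Density of a Lévy measure with low singularity: a non-negative (Borel) function $\mu:[0,\infty)\to[0,\infty)$ with $\int_{\mathbb{R}^N}(1\wedge|y|)\,\mu(|y|)\,dy<\infty$. Homogeneous jump kernel: a function $\rho:(\mathbb{R}\times\mathbb{R})\times(\mathbb{R}^N\times\mathbb{R}^N)\to\mathbb{R}$, written $\rho(a,b;x,y)$, such that for all $a,b,c,d\in\mathbb{R}$ and almost every $(x,y)\in\mathbb{R}^N\times\mathbb{R}^N$: (A1) $\rho$ is a non-negative Borel function; (A2) $\rho(a,b;x,y)=\rho(b,a;y,x)$; (A3) $(a-b)\rho(a,b;x,y)\ge(c-d)\rho(c,d;x,y)$ whenever $a\ge c\ge d\ge b$; (A4) $\rho(a,b;x,y)=\rho(a,b;|x-y|)$, i.e. $\rho$ depends on $x,y$ only through $|x-y|$; (A5) for every $R>0$ there is a function $m_R:[0,\infty)\to[0,\infty)$ such that $\sup_{-R\le a,b\le R}\rho(a,b;x,y)\le m_R(|x-y|)$ and $\int_{\mathbb{R}^N}(1\wedge|y|)\,m_R(|y|)\,dy=K_R<\infty$; (A6) $\rho$ is continuous with respect to the first two variables, and for every $\varepsilon>0$ and every $R>\varepsilon$ there is a constant $C_{R,\varepsilon}$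 such that $|\rho(a,b;x,y)-\rho(c,d;x,y)|\le C_{R,\varepsilon}(|a-c|+|b-d|)\,m_R(|x-y|)$ for all $a,b,c,d\in[-R,R]$ with $|a-b|\ge\varepsilon$ and $|c-d|\ge\varepsilon$. *)

(* Defs.v *)
From HB Require Import structures.
From mathcomp Require Import all_boot all_order all_algebra.
From mathcomp Require Import all_classical all_reals all_analysis.

Set Implicit Arguments.
Unset Strict Implicit.
Unset Printing Implicit Defensive.

Import Order.TTheory GRing.Theory Num.Theory.
Import numFieldNormedType.Exports.

Local Open Scope classical_set_scope.
Local Open Scope ring_scope.

(* R^N. The sigma-algebra that the library puts on n.-tuple is the one generated
   by the coordinates, which is here the Borel sigma-algebra of R^N. *)
Notation euclid R N := (N.-tuple (measurableTypeR R)).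

Section euclid.
Context {R : realType}.

Definition enorm N (x : euclid R N) : R :=
  Num.sqrt (\sum_(i < N) (tnth x i : R) ^+ 2).

Definition esub N (x y : euclid R N) : euclid R N :=
  [tuple (tnth x i : R) - tnth y i | i < N].

Definition euclid_cons N (p : measurableTypeR R * euclid R N) :
  euclid R N.+1 := [tuple of p.1 :: p.2].

Definition euclid_uncons N (x : euclid R N.+1) :
  measurableTypeR R * euclid R N := (thead x, [tuple of behead x]).

Lemma measurable_euclid_cons N : measurable_fun setT (@euclid_cons N).
Proof. exact: (measurable_cons measurable_fst measurable_snd). Qed.

Lemma measurable_euclid_uncons N : measurable_fun setT (@euclid_uncons N).
Proof.
apply/measurable_fun_pairP; split.
  exact: (@measurable_tnth _ (measurableTypeR R) N.+1 ord0).
exact: (@measurable_behead _ (measurableTypeR R) N).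
Qed.

Lemma euclid_consK N : cancel (@euclid_cons N) (@euclid_uncons N).
Proof.
move=> [a x]; rewrite /euclid_uncons /euclid_cons/= theadE.
by congr pair; apply/val_inj.
Qed.

Section lebesgue_cons.
Local Open Scope ereal_scope.
Variables (N : nat) (m : {sigma_finite_measure set (euclid R N) -> \bar R}).

Definition lebesgue_cons : set (euclid R N.+1) -> \bar R :=
  pushforward (@lebesgue_measure R \x m) (@euclid_cons N).

Let lebesgue_cons_meas (A : set (euclid R N.+1)) :
  measurable A -> measurable (@euclid_cons N @^-1` A).
Proof.
by move=> mA; rewrite -[X in measurable X]setTI; exact: measurable_euclid_cons.
Qed.

Let lebesgue_cons0 : lebesgue_cons set0 = 0.
Proof. by rewrite /lebesgue_cons /pushforward preimage_set0 measure0. Qed.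

Let lebesgue_cons_ge0 A : 0 <= lebesgue_cons A.
Proof. by rewrite /lebesgue_cons /pushforward measure_ge0. Qed.

Let lebesgue_cons_sigma_additive : semi_sigma_additive lebesgue_cons.
Proof.
move=> F mF tF mUF; rewrite /lebesgue_cons /pushforward preimage_bigcup.
apply: measure_semi_sigma_additive.
- by move=> n; exact: lebesgue_cons_meas.
- apply/trivIsetP => /= i j _ _ ij; rewrite -preimage_setI.
  by move/trivIsetP : tF => /(_ _ _ _ _ ij) ->//; rewrite preimage_set0.
- by rewrite -preimage_bigcup; exact: lebesgue_cons_meas.
Qed.

HB.instance Definition _ := isMeasure.Build _ _ _ lebesgue_cons
  lebesgue_cons0 lebesgue_cons_ge0 lebesgue_cons_sigma_additive.

Let lebesgue_cons_sigma_finite : sigma_finite setT lebesgue_cons.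
Proof.
have /sigma_finiteP[F [FT ndF Foo]] := sigma_finiteT (@lebesgue_measure R).
have /sigma_finiteP[G [GT ndG Goo]] := sigma_finiteT m.
exists (fun n => @euclid_uncons N @^-1` (F n `*` G n)).
  rewrite -preimage_bigcup (_ : \bigcup_n _ = setT) ?preimage_setT//.
  apply/seteqP; split => // -[a x] _.
  have [n _ Fna] : (\bigcup_n F n) a by rewrite -FT.
  have [k _ Gkx] : (\bigcup_n G n) x by rewrite -GT.
  exists (maxn n k) => //; split => /=.
  - by move: a Fna; exact/subsetPset/ndF/leq_maxl.
  - by move: x Gkx; exact/subsetPset/ndG/leq_maxr.
move=> n; have [mF Fnoo] := Foo n; have [mG Gnoo] := Goo n; split.
  rewrite -[X in measurable X]setTI.
  by apply: measurable_euclid_uncons => //; exact: measurableX.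
rewrite /lebesgue_cons /pushforward -comp_preimage.
rewrite (_ : _ \o _ = id); last by apply/funext => x /=; exact: euclid_consK.
rewrite preimage_id product_measure1E//.
by rewrite lte_mul_pinfty// ge0_fin_numE.
Qed.

HB.instance Definition _ := Measure_isSigmaFinite.Build _ _ _ lebesgue_cons
  lebesgue_cons_sigma_finite.

Definition lebesgue_cons_measure :
  {sigma_finite_measure set (euclid R N.+1) -> \bar R} := lebesgue_cons.

End lebesgue_cons.

(* Lebesgue measure on R^N, as an iterated product *)
Fixpoint lebesgue_euclid N :
    {sigma_finite_measure set (euclid R N) -> \bar R} :=
  match N with
  | 0 => dirac ([tuple] : euclid R 0)
  | N'.+1 => lebesgue_cons_measure (lebesgue_euclid N')
  end.

Lemma lebesgue_euclidX N (A : 'I_N -> set (measurableTypeR R)) :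
  (forall i, measurable (A i)) ->
  lebesgue_euclid N [set x : euclid R N | forall i, A i (tnth x i)] =
  (\prod_(i < N) lebesgue_measure (A i))%E.
Proof.
elim: N A => [|N IH] A mA /=.
  rewrite big_ord0 diracE mem_set//= => -[].
  by [].
rewrite big_ord_recl -IH// -product_measure1E//; last first.
  rewrite [X in measurable X](_ : _ = \bigcap_(i in [set: 'I_N])
      ((fun x : euclid R N => tnth x i) @^-1` A (lift ord0 i))); last first.
    by apply/seteqP; split => [x Ax i _|x Ax i]; exact: Ax.
  apply: fin_bigcap_measurable => [|i _]; first exact: finite_finset.
  by rewrite -[X in measurable X]setTI; exact: measurable_tnth.
rewrite /lebesgue_cons /pushforward; congr (product_measure1 _ _ _).
apply/seteqP; split => -[a x] /=.
  move=> H; split => [|i]; first exact: (H ord0).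
  by have := H (lift ord0 i); rewrite /euclid_cons tnthS.
move=> [Aa Ax] i; case: (unliftP ord0 i) => [j ->|->//].
by rewrite /euclid_cons tnthS.
Qed.

End euclid.

(* m stands for a Borel function [0, oo) -> [0, oo): its values at negative reals
   are irrelevant. Borel measurability is what gives the integral its usual
   meaning (the library's integral is total). *)
Definition low_singularity (R : realType) (N : nat) (m : R -> R) : Prop :=
  [/\ measurable_fun (`[0, +oo[ : set R) m,
      forall r, 0 <= r -> 0 <= m r &
      (\int[@lebesgue_euclid R N]_y
         (Num.min 1 (enorm y) * m (enorm y))%:E < +oo)%E].

(* In each axiom the exceptional null set of pairs (x, y) does not depend on the
   first two variables of rho: the supremum in [jump_bounded] and the continuity
   in [jump_continuous] need this. For the other axioms it is formally stronger
   than one null set for each choice of a, b, c, d.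
   The radius, called K below, replaces the letter R, which is the real field. *)
Section jump_kernel.
Variables (R : realType) (N : nat).

Local Notation lebesgue2 := (@lebesgue_euclid R N \x @lebesgue_euclid R N)%E.

Variable rho : (R * R) * (euclid R N * euclid R N) -> R.

Definition jump_symmetric : Prop :=
  {ae lebesgue2, forall z, forall a b : R,
    rho ((a, b), (z.1, z.2)) = rho ((b, a), (z.2, z.1))}.

Definition jump_monotone : Prop :=
  {ae lebesgue2, forall z, forall a b c d : R,
    a >= c -> c >= d -> d >= b ->
    (a - b) * rho ((a, b), z) >= (c - d) * rho ((c, d), z)}.

Definition jump_homogeneous : Prop :=
  exists r : R -> R -> R -> R,
  {ae lebesgue2, forall z, forall a b : R,
    rho ((a, b), z) = r a b (enorm (esub z.1 z.2))}.

Definition jump_bounded (m : R -> R -> R) : Prop :=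
  forall K : R, 0 < K ->
  low_singularity N (m K) /\
  {ae lebesgue2, forall z,
    (ereal_sup [set (rho (ab, z))%:E | ab in `[(- K)%R, K] `*` `[(- K)%R, K]]
     <= (m K (enorm (esub z.1 z.2)))%:E)%E}.

Definition jump_continuous : Prop :=
  {ae lebesgue2, forall z, continuous (fun ab : R * R => rho (ab, z))}.

Definition jump_lipschitz (m : R -> R -> R) : Prop :=
  forall e K : R, 0 < e -> e < K ->
  exists C : R, {ae lebesgue2, forall z, forall a b c d : R,
    a \in `[- K, K] -> b \in `[- K, K] ->
    c \in `[- K, K] -> d \in `[- K, K] ->
    e <= `|a - b| -> e <= `|c - d| ->
    `|rho ((a, b), z) - rho ((c, d), z)| <=
      C * (`|a - c| + `|b - d|) * m K (enorm (esub z.1 z.2))}.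

Record homogeneous_jump_kernel : Prop := HomogeneousJumpKernel {
  jump_ge0 : forall p, 0 <= rho p ;
  jump_measurable : measurable_fun setT rho ;
  jump_sym : jump_symmetric ;
  jump_mono : jump_monotone ;
  jump_homo : jump_homogeneous ;
  jump_cont : jump_continuous ;
  jump_bound : exists m : R -> R -> R, jump_bounded m /\ jump_lipschitz m
}.

End jump_kernel.

Definition difference_quotient (R : realType) (f : R -> R) (a b : R) : R :=
  if a == b then (f^`()%classic) a else (f a - f b) / (a - b).

(* Main.v *)
Require Import Defs.
From mathcomp Require Import all_boot all_order all_algebra.
From mathcomp Require Import all_classical all_reals all_analysis.
From mathcomp Require Import measurable_realfun ring lra.
Set Implicit Arguments.
Unset Strict Implicit.
Unset Printing Implicit Defensive.

Import Order.TTheory GRing.Theory Num.Theory.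
Import numFieldNormedType.Exports.
Local Open Scope classical_set_scope.
Local Open Scope ring_scope.

(** All the axioms reduce to properties of the difference quotient F of f,
    because the factor mu (|x - y|) is non-negative and does not involve the
    first two variables.

    The identity f a - f b = F a b * (a - b), valid on the diagonal too
    ([difference_quotientE]), turns the monotonicity axiom into the comparison
    f c - f d <= f a - f b for b <= d <= c <= a. By the mean value theorem,
    F a b is a value of f' at a point of any interval that contains a and b
    ([difference_quotient_mean_value]). This gives F >= 0 since f' >= 0, the
    continuity of F on the diagonal from that of f', and the bound of F on
    [-K, K]^2 by L_K, the maximum of f' on [-K, K].

    The function L_K * mu then serves as the dominating density for radius K.
    It also serves in the local Lipschitz axiom: away from the diagonal, F is
    Lipschitz on [-K, K]^2 with a constant proportional to L_K
    ([difference_quotient_lipschitz]), so L_K is absorbed in the density and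
    the constant 2 / e depends on the lower bound e for |a - b| only. *)

Lemma difference_quotientE (R : realType) (f : R -> R) (a b : R) :
  f a - f b = difference_quotient f a b * (a - b).
Proof.
rewrite /difference_quotient; case: eqVneq => [->|ab].
  by rewrite !subrr mulr0.
by rewrite divfK// subr_eq0.
Qed.

Lemma difference_quotientC (R : realType) (f : R -> R) (a b : R) :
  difference_quotient f a b = difference_quotient f b a.
Proof.
rewrite /difference_quotient eq_sym; case: eqVneq => [->//|_].
by rewrite -(opprB (f b)) -(opprB b) invrN mulrNN.
Qed.

(** The interval i is arbitrary so that one statement serves for global bounds,
    for bounds on a segment, and for small neighbourhoods of a diagonal point;
    the mean value point lies in i because i is order-convex. *)
Lemma difference_quotient_mean_value (R : realType) (f : R -> R)
    (i : interval R) (a b : R) : (forall x, derivable f x 1) ->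
  a \in i -> b \in i ->
  exists2 c, c \in i & difference_quotient f a b = f^`()%classic c.
Proof.
move=> df; wlog ab : a b / a <= b => [mv ai bi|ai bi].
  have [/mv|/ltW/mv] := leP a b; first exact.
  by rewrite difference_quotientC; exact.
move: ab; rewrite le_eqVlt => /predU1P[<-|ab].
  by exists a => //; rewrite /difference_quotient eqxx.
have [||c cab fE] := @MVT_segment R f f^`()%classic _ _ (ltW ab).
- by move=> x _; rewrite derive1E; exact: derivableP.
- by apply: derivable_within_continuous => x _; exact: df.
exists c.
  by move: cab; rewrite in_itv/=; apply: (@interval_is_interval _ i).
rewrite difference_quotientC /difference_quotient gt_eqF// fE mulfK//.
by rewrite subr_eq0 gt_eqF.
Qed.

Lemma nondecreasing_derive1_ge0 (R : realType) (f : R -> R) (x : R) :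
  derivable f x 1 -> {homo f : x y / x <= y} -> 0 <= f^`()%classic x.
Proof.
move=> df ndf; rewrite derive1E/derive; apply: limr_ge; first exact: df.
near=> h; rewrite /GRing.scale/= mulr1.
have [h0|h0] := leP 0 h.
  by rewrite mulr_ge0 ?invr_ge0// subr_ge0 ndf// lerDr.
by rewrite mulr_le0 ?invr_le0 ?(ltW h0)// subr_le0 ndf// gerDr ltW.
Unshelve. all: by end_near. Qed.

Lemma difference_quotient_ge0 (R : realType) (f : R -> R) (a b : R) :
  (forall x, derivable f x 1) -> {homo f : x y / x <= y} ->
  0 <= difference_quotient f a b.
Proof.
move=> df ndf.
have [||c _ ->] := @difference_quotient_mean_value R f `]-oo, +oo[ a b df.
- by rewrite in_itv.
- by rewrite in_itv.
exact: nondecreasing_derive1_ge0.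
Qed.

(** Off the diagonal F is locally a quotient of continuous functions. Near a
    diagonal point (y, y), its values are values of f' near y. *)
Lemma difference_quotient_continuous (R : realType) (f : R -> R) :
  (forall x, derivable f x 1) -> continuous (f^`()%classic) ->
  continuous (fun ab : R * R => difference_quotient f ab.1 ab.2).
Proof.
move=> df cdf [x y]; have [->|xy] := eqVneq x y.
  rewrite /continuous_at/= [X in _ --> X](_ : _ = f^`()%classic y); last first.
    by rewrite /difference_quotient eqxx.
  apply/cvgrPdist_lt => e e0.
  have /cvgrPdist_lt/(_ e e0)/nbhs_ballP[d /= d0 fd] := cdf y.
  have yd : nbhs y (ball y d) by exact: nbhsx_ballx.
  have : nbhs (y, y) (ball y d `*` ball y d) by exists (ball y d, ball y d).
  apply: filterS => -[a b] [/=]; rewrite -!ball_normE/= => ya yb.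
  have [||c cyd ->] := @difference_quotient_mean_value R f `]y - d, y + d[ a b df.
  - by rewrite in_itv/= -ltr_distl distrC.
  - by rewrite in_itv/= -ltr_distl distrC.
  - apply: fd; rewrite -ball_normE/= distrC ltr_distl.
    by move: cyd; rewrite in_itv.
have cf : continuous f.
  by move=> z; exact/differentiable_continuous/derivable1_diffP.
have c1 : {for (x, y), continuous (fun ab : R * R => f ab.1)}.
  by apply: continuous_comp; [exact: cvg_fst|exact: cf].
have c2 : {for (x, y), continuous (fun ab : R * R => f ab.2)}.
  by apply: continuous_comp; [exact: cvg_snd|exact: cf].
have cD : {for (x, y), continuous (fun ab : R * R => ab.1 - ab.2)}.
  by apply: continuousB; [exact: cvg_fst|exact: cvg_snd].
have xy0 : x - y != 0 by rewrite subr_eq0.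
have cq : {for (x, y), continuous
    (fun ab : R * R => (f ab.1 - f ab.2) / (ab.1 - ab.2))}.
  by apply: continuousM; [exact: continuousB|exact: continuousV].
rewrite /continuous_at/= [X in _ --> X](_ : _ = (f x - f y) / (x - y)); last first.
  by rewrite /difference_quotient (negbTE xy).
apply: cvg_trans cq; apply: near_eq_cvg.
have : \forall ab \near (x, y), ab.1 - ab.2 != 0.
  exact: (@cvgr_neq0 _ _ _ _ _ _ _ cD xy0).
apply: filterS => -[a b] /=; rewrite subr_eq0 => /negbTE ab.
by rewrite /difference_quotient ab.
Qed.

Lemma difference_quotient_bounded (R : realType) (f : R -> R) (K : R) :
  (forall x, derivable f x 1) -> continuous (f^`()%classic) ->
  {homo f : x y / x <= y} ->
  exists2 L, 0 <= L & forall a b, a \in `[- K, K] -> b \in `[- K, K] ->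
    difference_quotient f a b <= L.
Proof.
move=> df cdf ndf; have [K0|K0] := leP 0 K; last first.
  exists 0 => // a b; rewrite in_itv/= => /andP[Ka aK].
  lra.
have [|c _ fc] := @EVT_max R f^`()%classic (- K) K _ (continuous_subspaceT cdf).
  by rewrite ge0_cp.
exists (f^`()%classic c) => [|a b aK bK]; first exact: nondecreasing_derive1_ge0.
by have [d dK ->] := difference_quotient_mean_value df aK bK; exact: fc.
Qed.

(** Write F for the difference quotient. From
    (f a - f b) - (f c - f d) = (f a - f c) - (f b - f d) one gets
    (F a b - F c d) (a - b) = (F a c - F c d) (a - c) - (F b d - F c d) (b - d),
    where both differences of values of F on the right are at most 2 L in
    absolute value; it remains to divide by a - b, for which |a - b| >= e. *)
Lemma difference_quotient_lipschitz (R : realType) (f : R -> R)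
    (L e a b c d : R) :
  0 < e -> e <= `|a - b| ->
  `|difference_quotient f a c| <= L -> `|difference_quotient f b d| <= L ->
  `|difference_quotient f c d| <= L ->
  `|difference_quotient f a b - difference_quotient f c d| <=
    2 / e * (`|a - c| + `|b - d|) * L.
Proof.
move=> e0 eab Lac Lbd Lcd.
set G := difference_quotient f in Lac Lbd Lcd *.
have GE : (G a b - G c d) * (a - b) =
    (G a c - G c d) * (a - c) - (G b d - G c d) * (b - d).
  have := difference_quotientE f a b; have := difference_quotientE f c d.
  have := difference_quotientE f a c; have := difference_quotientE f b d.
  rewrite -/G; lra.
have G2 x : `|x| <= L -> `|x - G c d| <= 2 * L.
  by move=> xL; rewrite (le_trans (ler_normB _ _))// mulr_natl mulr2n lerD.
rewrite -(ler_pM2r e0) (@le_trans _ _ (`|G a b - G c d| * `|a - b|))//.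
  by rewrite ler_wpM2l.
have -> : 2 / e * (`|a - c| + `|b - d|) * L * e =
    2 * L * `|a - c| + 2 * L * `|b - d|.
  by field; rewrite gt_eqF.
rewrite -normrM GE (le_trans (ler_normB _ _))// !normrM.
by rewrite lerD// ler_wpM2r// G2.
Qed.

(** The inverse is continuous away from 0, and the value at the single point 0
    does not affect measurability. *)
Lemma measurable_inv (R : realType) : measurable_fun [set: R] (@GRing.inv R).
Proof.
rewrite (_ : @GRing.inv R = fun x => if x == 0 then 0 else x^-1); last first.
  by apply/funext => x; case: eqVneq => // ->; rewrite invr0.
apply: measurable_fun_if => //; first exact: measurable_fun_eqr.
rewrite setTI (_ : _ @^-1` _ = [set x : R | x != 0]); last first.
  by apply/seteqP; split => x /=; [move=> ->|move/negbTE].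
apply: open_continuous_measurable_fun; first exact: open_neq.
by move=> x; rewrite inE/= => x0; exact: inv_continuous.
Qed.

Lemma measurable_difference_quotient (R : realType) (f : R -> R) :
  measurable_fun setT f -> measurable_fun setT (f^`()%classic) ->
  measurable_fun setT (fun ab : R * R => difference_quotient f ab.1 ab.2).
Proof.
move=> mf mdf; rewrite /difference_quotient; apply: measurable_fun_ifT.
- exact: measurable_fun_eqr.
- exact: (measurableT_comp mdf).
- apply: measurable_funM.
    by apply: measurable_funB; exact: (measurableT_comp mf).
  by apply: (measurableT_comp (@measurable_inv R)); exact: measurable_funB.
Qed.

Lemma enorm_ge0 (R : realType) (N : nat) (x : euclid R N) : 0 <= enorm x.
Proof. exact: sqrtr_ge0. Qed.

Lemma enorm_esubC (R : realType) (N : nat) (x y : euclid R N) :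
  enorm (esub x y) = enorm (esub y x).
Proof.
rewrite /enorm; congr Num.sqrt; apply: eq_bigr => i _.
by rewrite !tnth_mktuple -sqrrN opprB.
Qed.

Lemma measurable_enorm (R : realType) (N : nat) :
  measurable_fun setT (@enorm R N).
Proof.
apply: measurableT_comp.
  by apply: continuous_measurable_fun; exact: sqrt_continuous.
apply: measurable_sum => i; apply: measurable_funX.
exact: measurable_tnth.
Qed.

Lemma measurable_enorm_esub (R : realType) (N : nat) :
  measurable_fun setT (fun z : euclid R N * euclid R N => enorm (esub z.1 z.2)).
Proof.
apply: (measurableT_comp (@measurable_enorm R N)).
apply/measurable_fun_tnthP => i.
rewrite [X in measurable_fun _ X](_ : _ =
    fun z => (tnth z.1 i : R) - (tnth z.2 i : R)); last first.
  by apply/funext => z /=; rewrite tnth_mktuple.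
have mt := @measurable_tnth _ (measurableTypeR R) N i.
apply: measurable_funB.
- exact: (measurableT_comp mt measurable_fst).
- exact: (measurableT_comp mt measurable_snd).
Qed.

(** A radial density is assumed measurable on [0, +oo[ only. *)
Lemma measurable_comp_ge0 d (T : measurableType d) (R : realType)
    (m : R -> R) (g : T -> R) :
  measurable_fun (`[0, +oo[ : set R) m -> (forall t, 0 <= g t) ->
  measurable_fun setT g -> measurable_fun setT (m \o g).
Proof.
move=> mm g0 mg; apply: (measurable_comp _ _ mm mg) => //.
by move=> _ [t _ <-]; rewrite /= in_itv/= andbT.
Qed.

Lemma low_singularityZ (R : realType) (N : nat) (k : R) (m : R -> R) :
  0 <= k -> low_singularity N m -> low_singularity N (fun r => k * m r).
Proof.
move=> k0 [mm m0 moo]; split.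
- exact: measurable_funM.
- by move=> r r0; rewrite mulr_ge0// m0.
under eq_integral do rewrite mulrCA EFinM.
rewrite ge0_integralZl_EFin//.
- rewrite lte_mul_pinfty// ?lee_fin//.
- by move=> y _; rewrite lee_fin mulr_ge0 ?m0 ?enorm_ge0// le_min ler01 enorm_ge0.
- apply/measurable_EFinP; apply: measurable_funM.
    by apply: measurable_minr => //; exact: measurable_enorm.
  apply: (measurable_comp_ge0 mm); [exact: enorm_ge0|exact: measurable_enorm].
Qed.

Theorem proposition5p3 (R : realType) (N : nat) (f mu : R -> R) :
  (0 < N)%N ->
  (forall x, derivable f x 1) -> continuous (f^`()%classic) ->
  {homo f : x y / x <= y} ->
  low_singularity N mu ->
  homogeneous_jump_kernel
    (fun p : (R * R) * (euclid R N * euclid R N) =>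
       difference_quotient f p.1.1 p.1.2 * mu (enorm (esub p.2.1 p.2.2))).
Proof.
move=> _ df cdf ndf lsmu; have [mmu mu0 _] := lsmu.
have muz (z : euclid R N * euclid R N) : 0 <= mu (enorm (esub z.1 z.2)).
  exact/mu0/enorm_ge0.
have F0 a b : 0 <= difference_quotient f a b by exact: difference_quotient_ge0.
split.
- by move=> p; rewrite mulr_ge0.
- apply: measurable_funM.
    apply: (measurableT_comp
      (f := fun ab : R * R => difference_quotient f ab.1 ab.2)).
      apply: measurable_difference_quotient;
        apply: continuous_measurable_fun => //.
      by move=> z; exact/differentiable_continuous/derivable1_diffP.
    exact: measurable_fst.
  apply: (measurable_comp_ge0
    (g := fun p : (R * R) * (euclid R N * euclid R N) =>
      enorm (esub p.2.1 p.2.2)) mmu) => [p|]; first exact: enorm_ge0.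
  exact: (measurableT_comp (@measurable_enorm_esub R N) measurable_snd).
- by apply: aeW => z a b /=; rewrite difference_quotientC enorm_esubC.
- apply: aeW => z a b c d ca dc bd /=; rewrite !mulrA ler_wpM2r//.
  rewrite ![(_ - _) * _]mulrC -!difference_quotientE.
  by rewrite lerB// ndf.
- exists (fun a b s => difference_quotient f a b * mu s).
  by apply: aeW.
- apply: aeW => z ab.
  apply: (@continuousM R _ (fun ab : R * R => difference_quotient f ab.1 ab.2)
    (fun=> mu (enorm (esub z.1 z.2)))); last exact: cst_continuous.
  exact: difference_quotient_continuous.
- have /choice[L L_bound] : forall K : R, exists L, 0 <= L /\
      forall a b, a \in `[- K, K] -> b \in `[- K, K] ->
        difference_quotient f a b <= L.
    move=> K; have [L L0 FL] := difference_quotient_bounded K df cdf ndf.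
    by exists L.
  exists (fun K r => L K * mu r); split => [K K0|e K e0 eK].
    have [L0 FL] := L_bound K; split; first exact: low_singularityZ.
    apply: aeW => z; apply: ge_ereal_sup => _ [[a b] [/= aK bK] <-].
    by rewrite lee_fin ler_wpM2r// FL.
  exists (2 / e); apply: aeW => z a b c d aK bK cK dK eab _ /=.
  have [_ FL] := L_bound K.
  rewrite -mulrBl normrM (ger0_norm (muz z)) mulrA ler_wpM2r//.
  by apply: difference_quotient_lipschitz; rewrite // ger0_norm// FL.
Qed.
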